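(* Let $N\in\mathbb N$. The projective spaces $P^{N-1}_{\mathbb R}\subset P^{N-1}_{\mathbb C}\subset P^{N-1}_+$ are the only monomial spaces. That is, these three spaces are monomial, and every monomial space $P\subset P^{N-1}_+$ is equal to one of $P^{N-1}_{\mathbb R}$, $P^{N-1}_{\mathbb C}$, $P^{N-1}_+$.
   Context: The category of noncommutative compact spaces is the category of unital $C^*$-algebras with arrows reversed. The algebra corresponding to a space $X$ is written $C(X)$. A (closed) subset $Y\subset X$ is a quotient $C(X)\to C(Y)$ of unital $C^*$-algebras. The subset of $X$ obtained via a family of relations is the one whose algebra is the quotient of $C(X)$ by the closed two-sided ideal generated by these relations. Two subsets of $X$ are equal when the corresponding quotients of $C(X)$ have the same kernel. The free projective space $P^{N-1}_+$ is defined by the universal unital $C^*$-algebra $$C(P^{N-1}_+)=C^*\Big((p_{ij})_{i,j=1,\ldots,N}\,\Big|\,p=p^*=p^2,\ \mathrm{Tr}(p)=1\Big),$$ where $p=(p_{ij})$ is regarded as a matrix with entries in the algebra, $(p^* )_{ij}=p_{ji}^*$, and $\mathrm{Tr}(p)=\sum_i p_{ii}$. The usual complex and real projective spaces $P^{N-1}_{\mathbb C},P^{N-1}_{\mathbb R}$ are identified with the spaces of rank one projections in $M_N(\mathbb C)$, $M_N(\mathbb R)$, with $p_{ij}$ being the matrix coordinates. Thus $P^{N-1}_{\mathbb C}\subset P^{N-1}_+$ is obtained by imposing commutativity of all the $p_{ij}$ (and of their adjoints), and $P^{N-1}_{\mathbb R}\subset P^{N-1}_{\mathbb C}$ by further imposing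 $p_{ij}=p_{ji}$ for all $i,j$. For a permutation $\sigma\in S_k$ with $k$ even, let $\mathcal R_\sigma$ be the family of relations $$p_{i_1i_2}\cdots p_{i_{k-1}i_k}=p_{i_{\sigma(1)}i_{\sigma(2)}}\cdots p_{i_{\sigma(k-1)}i_{\sigma(k)}},\qquad\forall (i_1,\ldots,i_k)\in\{1,\ldots,N\}^k.$$ For $\sigma\in S_k$, let $|\sigma|\in S_{k+2}$ be the permutation obtained by adding a fixed point to the left and a fixed point to the right of $\sigma$, i.e. $|\sigma|(1)=1$, $|\sigma|(j+1)=\sigma(j)+1$ for $1\le j\le k$, and $|\sigma|(k+2)=k+2$. A monomial space is a subset $P\subset P^{N-1}_+$ obtained via the relations $\mathcal R_\sigma$, with $\sigma$ ranging over a certain (possibly empty) subset of $\bigcup_{k\in 2\mathbb N}S_k$ which is stable under the operation $\sigma\to|\sigma|$. *)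

(* Defs.v *)
From HB Require Import structures.
From mathcomp Require Import all_boot all_order all_algebra all_fingroup.
From mathcomp Require Import all_classical all_reals all_analysis.
From mathcomp Require Import complex.

Set Implicit Arguments.
Unset Strict Implicit.
Unset Printing Implicit Defensive.

Import Order.TTheory GRing.Theory Num.Theory.
Import numFieldNormedType.Exports.
Local Open Scope classical_set_scope.
Local Open Scope ring_scope.

(* The norm of a normed module over R[i] takes its values in R[i]. The axiom
   1 != 0 of the library's [algType] is not imposed: the zero algebra (the empty
   space) is a unital C*-algebra. The product is part of the mixin because the
   hierarchy has no join of rings and normed modules below the number domains;
   the ring structure is recovered as an instance below. *)
HB.mixin Record isCStarAlgebra (R : realType) A
    of CompleteNormedModule R[i] A := {
  cstar_one : A;
  cstar_mul : A -> A -> A;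
  star : A -> A;
  cstar_mulA : associative cstar_mul;
  cstar_mul1l : left_id cstar_one cstar_mul;
  cstar_mul1r : right_id cstar_one cstar_mul;
  cstar_mulDl : left_distributive cstar_mul +%R;
  cstar_mulDr : right_distributive cstar_mul +%R;
  cstar_scalerAl : forall (a : R[i]) (x y : A),
    a *: cstar_mul x y = cstar_mul (a *: x) y;
  cstar_scalerAr : forall (a : R[i]) (x y : A),
    a *: cstar_mul x y = cstar_mul x (a *: y);
  starK : involutive star;
  starD : {morph star : x y / x + y};
  starZ : forall (a : R[i]) (x : A), star (a *: x) = a^* *: star x;
  starM : forall x y : A, star (cstar_mul x y) = cstar_mul (star y) (star x);
  cstar_normM : forall x y : A, `|cstar_mul x y| <= `|x| * `|y|;
  cstar_identity : forall x : A, `|cstar_mul (star x) x| = `|x| ^+ 2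
}.

#[short(type="cstarAlgType")]
HB.structure Definition CStarAlgebra (R : realType) :=
  {A of isCStarAlgebra R A & CompleteNormedModule R[i] A}.

HB.instance Definition _ (R : realType) (A : cstarAlgType R) :=
  GRing.Zmodule_isPzRing.Build A (@cstar_mulA R A) (@cstar_mul1l R A)
    (@cstar_mul1r R A) (@cstar_mulDl R A) (@cstar_mulDr R A).

Definition is_star_hom (R : realType) (A B : cstarAlgType R) (f : A -> B) :=
  [/\ linear f, monoid_morphism f & forall x, f (star x) = star (f x)].

Section Subsets.
Context (R : realType) (A : cstarAlgType R).

(* [A] plays the role of C(X); a subset Y of X is a quotient map
   C(X) -> C(Y), written here [restr]. *)
Record nc_subset := NCSubset {
  fun_alg : cstarAlgType R;
  restr : A -> fun_alg;
  restr_hom : is_star_hom restr;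
  restr_surj : forall y, exists x, restr x = y
}.

Definition ker_restr (Y : nc_subset) : set A := [set x | restr Y x = 0].

Definition subset_eq (Y Z : nc_subset) := ker_restr Y = ker_restr Z.

Lemma id_star_hom : is_star_hom (@id A).
Proof. by split. Qed.

Lemma id_surj (y : A) : exists x : A, id x = y.
Proof. by exists y. Qed.

Definition whole : nc_subset := NCSubset id_star_hom id_surj.

Definition two_sided_ideal (J : set A) :=
  [/\ J 0, forall x y, J x -> J y -> J (x + y) &
      forall a x b, J x -> J (a * x * b)].

Definition closed_ideal_gen (G : set A) : set A :=
  [set x | forall J, closed J -> two_sided_ideal J -> G `<=` J -> J x].

(* A pair (x, y) in [rels] stands for the relation x = y. *)
Definition obtained_via (Y : nc_subset) (rels : set (A * A)) :=
  ker_restr Y = closed_ideal_gen [set r.1 - r.2 | r in rels].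

End Subsets.

Arguments whole {R} A.

Definition is_trace1_projection (R : realType) (N : nat) (A : cstarAlgType R)
    (p : 'M[A]_N) :=
  [/\ map_mx star p^T = p, p *m p = p & \tr p = 1].

Record free_projective_space (R : realType) (N : nat) := FreeProjectiveSpace {
  proj_alg : cstarAlgType R;
  coord : 'M[proj_alg]_N;
  coord_proj : is_trace1_projection coord;
  coord_universal : forall (B : cstarAlgType R) (q : 'M[B]_N),
    is_trace1_projection q ->
    exists! f : proj_alg -> B, is_star_hom f /\ map_mx f coord = q
}.

(* Positions are numbered from 0: the (j+1)-st letter p_{i_{2j+1} i_{2j+2}} of
   a word of length m uses the positions 2j and 2j+1. *)
Lemma left_pos_subproof m (j : 'I_m) : (j.*2 < m.*2)%N.
Proof. by rewrite ltn_double. Qed.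

Lemma right_pos_subproof m (j : 'I_m) : (j.*2.+1 < m.*2)%N.
Proof. by rewrite ltn_Sdouble. Qed.

Definition left_pos m (j : 'I_m) : 'I_m.*2 := Ordinal (left_pos_subproof j).
Definition right_pos m (j : 'I_m) : 'I_m.*2 := Ordinal (right_pos_subproof j).

(* 'S_(m.+1.*2) and 'S_(m.*2).+2 are convertible. *)
Definition bars m (s : 'S_(m.*2)) : 'S_(m.+1.*2) :=
  lift_perm ord0 ord0 (lift_perm ord_max ord_max s).

(* A subset of the disjoint union of the S_k with k = m.*2 even. *)
Definition perm_family := forall m, set 'S_(m.*2).

Definition bars_stable (E : perm_family) :=
  forall m (s : 'S_(m.*2)), E m s -> E m.+1 (bars s).

Section ProjectiveSpaces.
Context (R : realType) (N : nat) (X : free_projective_space R N).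
Local Notation A := (proj_alg X).
Local Notation p := (coord X).

Definition word m (i : 'I_m.*2 -> 'I_N) : A :=
  \prod_(j < m) p (i (left_pos j)) (i (right_pos j)).

Definition perm_relations (E : perm_family) : set (A * A) :=
  [set r | exists m (s : 'S_(m.*2)) (i : 'I_m.*2 -> 'I_N),
     E m s /\ r = (word i, word (i \o s))].

Definition is_monomial (P : nc_subset A) :=
  exists2 E, bars_stable E & obtained_via P (perm_relations E).

Definition coords_and_adjoints : set A :=
  [set x | exists i j, x = p i j \/ x = star (p i j)].

Definition complex_relations : set (A * A) :=
  [set r | exists x y, [/\ coords_and_adjoints x, coords_and_adjoints y &
                           r = (x * y, y * x)]].

Definition real_relations : set (A * A) :=
  complex_relations `|` [set r | exists i j, r = (p i j, p j i)].

Definition is_complex_projective (P : nc_subset A) :=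
  obtained_via P complex_relations.

Definition is_real_projective (P : nc_subset A) :=
  obtained_via P real_relations.

End ProjectiveSpaces.

(* Main.v *)
Require Import Defs.
From HB Require Import structures.
From mathcomp Require Import all_boot all_order all_algebra all_fingroup.
From mathcomp Require Import all_classical all_reals all_analysis.
From mathcomp Require Import complex zify ring.

Set Implicit Arguments.
Unset Strict Implicit.
Unset Printing Implicit Defensive.

Import Order.TTheory GRing.Theory Num.Theory.
Local Open Scope classical_set_scope.
Local Open Scope ring_scope.

(** The whole argument is algebraic: it takes place modulo an arbitrary two-sided
    ideal J, and since a closed generated ideal is an intersection of ideals,
    two families of relations define the same subset as soon as they lie in the
    same ideals J.  Analysis enters only through the fact that {0} is closed.

    Think of p_ij as z_i z_j^*, so that a word in the p_ij is an alternating word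
    in the letters z and z^*.  The identities p^2 = p and Tr p = 1 say that two
    equal neighbouring letters, summed over their common value, can be inserted
    or erased at any place of a word, whatever the parity of the place
    ([seq_word_insert]).  Stability under bars says that the rearrangement given
    by a permutation s of the family may be applied to any block of consecutive
    letters, at odd as well as at even places ([perm_fun_allowed]).

    Suppose s is not the identity.  Shift s so that its first moved place comes
    at the last moved place M of s itself.  The two permutations then move only
    M in common, so their commutator is a 3-cycle of the places A < M < B
    ([commutator_one_common_point]).  Erasing pairs of letters between these
    places leaves at most one letter in each gap, and in each of the four
    remaining cases one more erasure gives a transposition; in all of them letters
    at distance 2 can be exchanged ([parity_swaps_of_cycle]).  Hence the p_ij
    commute, and p_ij p_kl = p_il p_kj ([parity_swaps_commute],
    [parity_swaps_rank_one]).

    Conversely, commutation alone forces p_ij p_kl = p_il p_kj: over a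
    commutative ring an idempotent matrix of trace 1 has vanishing 2 x 2 minors
    if positive integers are not zero divisors ([rank_one_minors]).  Then all
    permutations preserving the parity of the places give valid relations, and
    so do all permutations if moreover p_ij = p_ji ([perm_word_perm]).  Finally
    a single permutation that changes a parity forces p_ij = p_ji
    ([symmetric_of_parity_break]).

    So a monomial space is the free one if its family contains only identities,
    the complex one if its family is parity-preserving but not trivial, and the
    real one otherwise. *)

(** * Rank one idempotents over a commutative ring *)

(** A triangularization by adjugates instead of inverses; taking determinants
    gives [det_bordered] up to a factor [\det P], which must be cancelled. *)
Lemma mulmx_bordered (C : comPzRingType) k (P : 'M[C]_k) u v (w : 'M[C]_1) :
  block_mx P u v w *m block_mx 1%:M (- (\adj P *m u)) 0 (\det P)%:M =
  block_mx P 0 v (\det P *: w - v *m \adj P *m u).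
Proof.
rewrite mulmx_block !mulmx1 !mulmx0 !addr0 !mulmxN !mulmxA mul_mx_adj.
rewrite -scalar_mxC addNr -!mul_scalar_mx.
by rewrite -scalar_mxC addrC.
Qed.

(** The factor [\det P] is cancelled by passing to the generic matrix P + X, whose
    determinant is monic; the formula is then evaluated at X = 0. *)
Lemma det_bordered (C : comNzRingType) k (P : 'M[C]_k) u v (w : 'M[C]_1) :
  \det (block_mx P u v w) = \det (\det P *: w - v *m \adj P *m u).
Proof.
pose X : {poly C} := 'X; pose c := @polyC C.
pose PX := char_poly_mx (- P).
pose l := block_mx PX (map_mx c u) (map_mx c v) (map_mx c w).
pose r := \det PX *: map_mx c w - map_mx c v *m \adj PX *m map_mx c u.
have: \det l = \det r.
  have := congr1 determinant (mulmx_bordered PX (map_mx c u) (map_mx c v) (map_mx c w)).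
  rewrite det_mulmx det_lblock det_ublock det1 mul1r det_scalar expr1 mulrC.
  by apply: monic_lreg; apply: char_poly_monic.
move=> /(congr1 (horner_eval 0)); rewrite -!det_map_mx /=.
have e0 : map_mx (horner_eval 0) PX = P.
  apply/matrixP=> i j; rewrite !mxE /horner_eval !hornerE.
  by rewrite hornerMn hornerX mul0rn sub0r opprK.
have ec m n (M : 'M[C]_(m, n)) : map_mx (horner_eval 0) (map_mx c M) = M.
  by apply/matrixP=> i j; rewrite !mxE /horner_eval hornerC.
rewrite /l map_block_mx e0 !ec => ->.
by rewrite /r map_mxB map_mxZ !map_mxM map_mx_adj !ec e0 -det_map_mx e0.
Qed.

Definition add_index N k (r : 'I_k -> 'I_N) (c : 'I_N) (i : 'I_(k + 1)) : 'I_N :=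
  match fintype.split i with inl i' => r i' | inr _ => c end.

(** Bordering a minor by a repeated index c and summing over c: the bordered
    determinant is [p c c * \det P] minus a quadratic term in the border, and
    p^2 = p collapses the sum of the latter to the trace of [\adj P *m P]. *)
Lemma sum_bordered_minors (C : comNzRingType) N (p : 'M[C]_N) k
    (r s : 'I_k -> 'I_N) : p *m p = p ->
  \sum_c \det (mxsub (add_index r c) (add_index s c) p) =
  (\tr p - k%:R) * \det (mxsub r s p).
Proof.
move=> pp; set P := mxsub r s p.
pose col c := colsub (fun _ : 'I_1 => c) (rowsub r p).
pose row c := rowsub (fun _ : 'I_1 => c) (colsub s p).
have minorE c : \det (mxsub (add_index r c) (add_index s c) p) =
    p c c * \det P - \tr (\adj P *m (col c *m row c)).
  have -> : mxsub (add_index r c) (add_index s c) p =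
      block_mx P (col c) (row c) (p c c)%:M.
    apply/matrixP=> i j; rewrite /block_mx !mxE /add_index.
    by case: (fintype.split i) => i'; rewrite !mxE; case: (fintype.split j) => j';
      rewrite !mxE // !ord1 eqxx.
  rewrite det_bordered det_mx11.
  rewrite mxE [in LHS]mxE [_%:M _ _]mxE mulr1n mulrC mxE; congr (_ - _).
  by rewrite mulmxA mxtrace_mulC mulmxA /mxtrace big_ord1.
rewrite (eq_bigr _ (fun c _ => minorE c)) sumrB -mulr_suml mulrBl; congr (_ - _).
rewrite -(raddf_sum (@mxtrace C k)) -mulmx_sumr.
have -> : \sum_c col c *m row c = P.
  apply/matrixP=> i j; rewrite summxE /P mxE -[in RHS]pp mxE.
  by apply: eq_bigr => c _; rewrite !mxE big_ord1 !mxE.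
by rewrite mul_adj_mx /= mxtrace_scalar mulr_natl.
Qed.

(** With trace 1 the factor of [sum_bordered_minors] is 1 - k, which is cancellable
    for k > 1.  So the vanishing of the minors of size k + 1 implies that of the
    minors of size k, down to k = 2, starting from sizes above N, where a minor
    has a repeated row. *)
Lemma rank_one_minors (C : comNzRingType) N (p : 'M[C]_N) :
  (forall n (x : C), n.+1%:R * x = 0 -> x = 0) ->
  p *m p = p -> \tr p = 1 ->
  forall i j k l, p i j * p k l = p i l * p k j.
Proof.
move=> torsion_free pp trp.
have minor0 d k (r s : 'I_k -> 'I_N) :
    (1 < k)%N -> (N < k + d)%N -> \det (mxsub r s p) = 0.
  (* d counts the sizes from k up to the first one that exceeds N *)
  elim: d k r s => [|d IHd] k r s k_gt1.
    rewrite addn0 => ltNk.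
    have /injectivePn[x [y xy rxy]] : ~~ injectiveb r.
      apply/negP => /injectiveP /leq_card; rewrite !card_ord; lia.
    by apply: (determinant_alternate xy) => j; rewrite !mxE rxy.
  move=> ltN.
  have := sum_bordered_minors r s pp; rewrite trp big1 => [|c _]; last first.
    by apply: IHd; lia.
  case: k r s k_gt1 ltN => [|[|k]] // r s _ _ /esym.
  have -> : 1 - k.+2%:R = - k.+1%:R :> C.
    by rewrite -[k.+2]addn1 natrD opprD addrCA subrr addr0.
  by rewrite mulNr => /eqP; rewrite oppr_eq0 => /eqP /torsion_free.
move=> i j k l.
pose pick2 (a b : 'I_N) (x : 'I_2) := if x == 0 then a else b.
have := minor0 N 2%N (pick2 i k) (pick2 j l) isT (leqnSn _).
rewrite (expand_det_row _ ord0) !big_ord_recl big_ord0 addr0 /cofactor !det_mx11.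
rewrite !mxE /= expr0 mul1r expr1 mulN1r mulrN => /subr0_eq ->.
by [].
Qed.

(** * Quotient rings and commutative subrings *)
Definition is_ideal (A : pzRingType) (J : set A) :=
  [/\ J 0, forall x y, J x -> J y -> J (x + y) &
      forall a x b, J x -> J (a * x * b)].

Section Ideal.
Context (A : pzRingType) (J : set A) (idealJ : is_ideal J).

Lemma ideal0 : J 0. Proof. by case: idealJ. Qed.

Lemma idealD x y : J x -> J y -> J (x + y).
Proof. by case: idealJ => _ + _; apply. Qed.

Lemma idealMl a x : J x -> J (a * x).
Proof. by case: idealJ => _ _ /(_ a x 1); rewrite mulr1. Qed.

Lemma idealMr x b : J x -> J (x * b).
Proof. by case: idealJ => _ _ /(_ 1 x b); rewrite mul1r. Qed.

Lemma idealN x : J x -> J (- x).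
Proof. by move=> /(idealMl (-1)); rewrite mulN1r. Qed.

End Ideal.

Section IdealQuotient.
Context (A : pzRingType) (J : set A) (idealJ : is_ideal J).

(** The quotient is modelled by the canonical representatives of the cosets. *)
Definition representative (x : A) := choose (fun y => `[< J (y - x) >]) x.

Lemma representativeP x : J (representative x - x).
Proof.
apply/asboolP; apply: (chooseP (P := fun y => `[< J (y - x) >])).
by apply/asboolP; rewrite subrr; apply: ideal0 idealJ.
Qed.

Lemma eq_representative x y : representative x = representative y <-> J (x - y).
Proof.
split=> [xy | Jxy].
  have := idealD idealJ (idealN idealJ (representativeP x)) (representativeP y).
  by rewrite xy opprB addrA subrK.
have eq_class : (fun z => `[< J (z - x) >]) =1 (fun z => `[< J (z - y) >]).
  move=> z; apply: asbool_equiv_eq; split=> Jz.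
    by have := idealD idealJ Jz Jxy; rewrite addrA subrK.
  have := idealD idealJ Jz (idealN idealJ Jxy).
  by rewrite opprB addrA subrK.
rewrite /representative (eq_choose eq_class); apply: choose_id.
  exact/asboolP.
by apply/asboolP; rewrite subrr; apply: ideal0 idealJ.
Qed.

Record coset_representative := CosetRepresentative {
  coset_val : A; _ : representative coset_val == coset_val }.

HB.instance Definition _ := [isSub for coset_val].
HB.instance Definition _ := [Choice of coset_representative by <:].

(** The proof that J is an ideal is a parameter of the type, since the ring
    structure put on it below depends on that proof. *)
Definition ideal_quotient of is_ideal J := coset_representative.

Local Notation Q := (ideal_quotient idealJ).

HB.instance Definition _ := SubType.on Q.
HB.instance Definition _ := Choice.on Q.

Lemma representative_idem x : representative (representative x) == representative x.
Proof. by apply/eqP/eq_representative/representativeP. Qed.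

Definition quotient_pi (x : A) : Q := CosetRepresentative (representative_idem x).

Lemma quotient_valK (u : Q) : quotient_pi (val u) = u.
Proof. by case: u => x xP; apply/val_inj/eqP. Qed.

Lemma quotient_ind (P : Q -> Prop) :
  (forall x, P (quotient_pi x)) -> forall u, P u.
Proof. by move=> Ppi u; rewrite -[u]quotient_valK. Qed.

Lemma quotient_piK x : J (val (quotient_pi x) - x).
Proof. exact: representativeP. Qed.

Lemma eq_quotientP x y : quotient_pi x = quotient_pi y <-> J (x - y).
Proof.
apply: iff_trans _ (eq_representative x y).
by split=> [xy | xy]; [exact: (congr1 (fun u : Q => \val u) xy) | exact: val_inj].
Qed.

Definition quotient_zero : Q := quotient_pi 0.
Definition quotient_one : Q := quotient_pi 1.
Definition quotient_opp (x : Q) : Q := quotient_pi (- val x).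
Definition quotient_add (x y : Q) : Q := quotient_pi (val x + val y).
Definition quotient_mul (x y : Q) : Q := quotient_pi (val x * val y).

Lemma quotient_piN x : quotient_opp (quotient_pi x) = quotient_pi (- x).
Proof.
apply/eq_quotientP; rewrite -opprD; apply: idealN => //.
exact: quotient_piK.
Qed.

Lemma quotient_piD x y : quotient_add (quotient_pi x) (quotient_pi y) = quotient_pi (x + y).
Proof.
apply/eq_quotientP; rewrite opprD addrACA.
by apply: idealD => //; apply: quotient_piK.
Qed.

Lemma quotient_piM x y : quotient_mul (quotient_pi x) (quotient_pi y) = quotient_pi (x * y).
Proof.
apply/eq_quotientP; move: (quotient_piK x) (quotient_piK y).
move: (val (quotient_pi x)) (val (quotient_pi y)) => x' y' Jx Jy.
have -> : x' * y' - x * y = (x' - x) * y' + x * (y' - y).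
  by rewrite mulrBl mulrBr addrA subrK.
by apply: (idealD idealJ); [apply: (idealMr idealJ) | apply: (idealMl idealJ)].
Qed.

Let piE := (quotient_piN, quotient_piD, quotient_piM).

Lemma quotient_addA : associative quotient_add.
Proof.
by elim/quotient_ind=> x; elim/quotient_ind=> y; elim/quotient_ind=> z;
  rewrite !piE addrA.
Qed.

Lemma quotient_addC : commutative quotient_add.
Proof. by elim/quotient_ind=> x; elim/quotient_ind=> y; rewrite !piE addrC. Qed.

Lemma quotient_add0 : left_id quotient_zero quotient_add.
Proof. by elim/quotient_ind=> x; rewrite !piE add0r. Qed.

Lemma quotient_addN : left_inverse quotient_zero quotient_opp quotient_add.
Proof. by elim/quotient_ind=> x; rewrite !piE addNr. Qed.

HB.instance Definition _ := GRing.isZmodule.Build Q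
  quotient_addA quotient_addC quotient_add0 quotient_addN.

Lemma quotient_mulA : associative quotient_mul.
Proof.
by elim/quotient_ind=> x; elim/quotient_ind=> y; elim/quotient_ind=> z;
  rewrite !piE mulrA.
Qed.

Lemma quotient_mul1l : left_id quotient_one quotient_mul.
Proof. by elim/quotient_ind=> x; rewrite !piE mul1r. Qed.

Lemma quotient_mul1r : right_id quotient_one quotient_mul.
Proof. by elim/quotient_ind=> x; rewrite !piE mulr1. Qed.

Lemma quotient_mulDl : left_distributive quotient_mul quotient_add.
Proof.
by elim/quotient_ind=> x; elim/quotient_ind=> y; elim/quotient_ind=> z;
  rewrite !piE mulrDl.
Qed.

Lemma quotient_mulDr : right_distributive quotient_mul quotient_add.
Proof.
by elim/quotient_ind=> x; elim/quotient_ind=> y; elim/quotient_ind=> z;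
  rewrite !piE mulrDr.
Qed.

HB.instance Definition _ := GRing.Zmodule_isPzRing.Build Q
  quotient_mulA quotient_mul1l quotient_mul1r quotient_mulDl quotient_mulDr.

Lemma quotient_pi_zmod : zmod_morphism quotient_pi.
Proof. by move=> x y; rewrite -quotient_piD -quotient_piN. Qed.

Lemma quotient_pi_monoid : monoid_morphism quotient_pi.
Proof. by split=> // x y; rewrite -quotient_piM. Qed.

HB.instance Definition _ :=
  GRing.isZmodMorphism.Build A Q quotient_pi quotient_pi_zmod.
HB.instance Definition _ :=
  GRing.isMonoidMorphism.Build A Q quotient_pi quotient_pi_monoid.

End IdealQuotient.

Lemma exists_quotient_ring (A : pzRingType) (J : set A) :
  is_ideal J -> ~ J 1 ->
  exists (Q : nzRingType) (f : {rmorphism A -> Q}), forall x, f x = 0 <-> J x.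
Proof.
move=> idealJ J1.
have pi0P x : quotient_pi idealJ x = 0 <-> J x.
  by have := eq_quotientP idealJ x 0; rewrite subr0.
have nonzero : (1 : ideal_quotient idealJ) != 0 by apply/eqP => /pi0P.
pose Q := HB.pack_for nzRingType (ideal_quotient idealJ)
  (GRing.PzSemiRing_isNonZero.Build (ideal_quotient idealJ) nonzero).
by exists Q, (quotient_pi idealJ).
Qed.

Section Bicommutant.
Context (Q : nzRingType) (I : Type) (q : I -> Q).
Hypothesis q_comm : forall i j, q i * q j = q j * q i.

(** A commuting family lies in its own commutant, so its bicommutant is
    commutative: this is how commutative algebra is applied to the coordinates
    without assuming that they generate the ring. *)
Definition bicommutant : {pred Q} :=
  fun x => `[< forall y, (forall i, y * q i = q i * y) -> x * y = y * x >].

Lemma bicommutantP x : reflect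
  (forall y, (forall i, y * q i = q i * y) -> x * y = y * x) (x \in bicommutant).
Proof. exact: asboolP. Qed.

Lemma bicommutant_subring : subring_closed bicommutant.
Proof.
split=> [|x y /bicommutantP xC /bicommutantP yC|x y /bicommutantP xC /bicommutantP yC];
  apply/bicommutantP=> z zC.
- by rewrite mul1r mulr1.
- by rewrite mulrBl mulrBr xC // yC.
- by rewrite -mulrA yC // mulrA xC // mulrA.
Qed.

HB.instance Definition _ := GRing.isSubringClosed.Build Q bicommutant
  bicommutant_subring.

Record bicommutant_ring := BicommutantRing {
  bicommutant_val :> Q; _ : bicommutant_val \in bicommutant }.

HB.instance Definition _ := [isSub for bicommutant_val].
HB.instance Definition _ := [Choice of bicommutant_ring by <:].
HB.instance Definition _ := [SubChoice_isSubNzRing of bicommutant_ring by <:].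

Lemma bicommutant_mulC : commutative (@GRing.mul bicommutant_ring).
Proof.
move=> [x xC] [y yC]; apply: val_inj; rewrite !rmorphM /=.
move/bicommutantP: xC; apply=> i.
by move/bicommutantP: yC; apply=> j.
Qed.

End Bicommutant.

Lemma exists_commutative_subring (Q : nzRingType) (I : Type) (q : I -> Q) :
  (forall i j, q i * q j = q j * q i) ->
  exists (C : comNzRingType) (f : {rmorphism C -> Q}),
    injective f /\ exists c : I -> C, forall i, f (c i) = q i.
Proof.
move=> q_comm.
pose C := HB.pack_for comNzRingType (bicommutant_ring q)
  (GRing.PzRing_hasCommutativeMul.Build (bicommutant_ring q)
     (bicommutant_mulC q_comm)).
exists C, val; split; first exact: val_inj.
have qC i : q i \in bicommutant q by apply/bicommutantP=> y /(_ i).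
by exists (fun i => BicommutantRing (qC i)).
Qed.

(** * Words and their rearrangements *)
Lemma pair_ind (T : Type) (P : seq T -> Prop) :
  P [::] -> (forall a, P [:: a]) -> (forall a b u, P u -> P [:: a, b & u]) ->
  forall u, P u.
Proof.
move=> P0 P1 P2 u; have [n] := ubnP (size u).
by elim: n u => // n IHn [|a [|b u]] //= /ltnW; rewrite ltnS => /IHn; apply: P2.
Qed.

Section Words.
Context (Q : pzRingType) (N : nat) (q : 'M[Q]_N).
Implicit Types (u v x y ys zs : seq 'I_N) (F G : nat -> nat).

(** A list of indices is read as a word in the letters z and z^*, two by two.
    Words of odd length get the value 0, so that exchanging two blocks of the same
    length is compatible with every context of the wrong parity. *)
Fixpoint seq_word u : Q :=
  if u is a :: u' then if u' is b :: v then q a b * seq_word v else 0 else 1.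

Lemma seq_word_odd u : odd (size u) -> seq_word u = 0.
Proof.
by elim/pair_ind: u => //= a b u IHu; rewrite negbK => /IHu ->; rewrite mulr0.
Qed.

Lemma seq_word_cat u v :
  ~~ odd (size u) -> seq_word (u ++ v) = seq_word u * seq_word v.
Proof.
elim/pair_ind: u => [|//|a b u IHu] /=; first by rewrite mul1r.
by rewrite negbK => /IHu ->; rewrite mulrA.
Qed.

(** The contexts x and y have arbitrary lengths, so the blocks may be exchanged
    from odd places as well as from even ones. *)
Definition interchangeable u v :=
  forall x y, seq_word (x ++ u ++ y) = seq_word (x ++ v ++ y).

Lemma interchangeable_sym u v : interchangeable u v -> interchangeable v u.
Proof. by move=> uv x y. Qed.

Lemma interchangeable_trans v u t :
  interchangeable u v -> interchangeable v t -> interchangeable u t.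
Proof. by move=> uv vt x y; rewrite uv. Qed.

Lemma interchangeable_cat x y u v :
  interchangeable u v -> interchangeable (x ++ u ++ y) (x ++ v ++ y).
Proof.
by move=> uv x' y'; have := uv (x' ++ x) (y ++ y'); rewrite -!catA.
Qed.

(** Rearrangements of n consecutive letters are given by functions on all of nat,
    so that rearrangements of blocks of different lengths can be composed. *)
Definition is_allowed n F := forall i : nat -> 'I_N,
  interchangeable [seq i j | j <- iota 0 n] [seq i (F j) | j <- iota 0 n].

Lemma is_allowed_comp n F G :
  is_allowed n F -> is_allowed n G -> is_allowed n (F \o G).
Proof.
by move=> Fn Gn i; apply: interchangeable_trans (Fn i) (Gn (i \o F)).
Qed.

Lemma is_allowed_inv n F G : cancel F G -> is_allowed n F -> is_allowed n G.
Proof.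
move=> FK Fn i; apply: interchangeable_sym => x y; rewrite (Fn (i \o G)) /=.
by under eq_map do rewrite FK.
Qed.

Definition shift_fun k F j := (if j < k then j else k + F (j - k))%N.

Lemma map_shift (T : Type) (f : nat -> T) n k l F :
    (forall j, (n <= j)%N -> F j = j) ->
  [seq f (shift_fun k F j) | j <- iota 0 (k + (n + l))] =
  [seq f j | j <- iota 0 k] ++ [seq f (k + F j)%N | j <- iota 0 n] ++
  [seq f j | j <- iota (k + n) l].
Proof.
move=> Fid; rewrite iotaD iotaD !map_cat add0n; congr (_ ++ (_ ++ _)).
- by apply/eq_in_map=> j; rewrite mem_iota add0n /shift_fun => /andP[_ ->].
- rewrite -[X in iota X n]addn0 iotaDl -map_comp; apply/eq_in_map=> j _ /=.
  by rewrite /shift_fun ltnNge leq_addr addKn.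
- apply/eq_in_map=> j; rewrite mem_iota => /andP[kn_j _].
  rewrite /shift_fun ltnNge (leq_trans (leq_addr _ _) kn_j) /= Fid; last by lia.
  by rewrite subnKC //; lia.
Qed.

Lemma is_allowed_shift n k l F : (forall j, (n <= j)%N -> F j = j) ->
  is_allowed n F -> is_allowed (k + (n + l)) (shift_fun k F).
Proof.
move=> Fid Fn i; rewrite map_shift //.
have := @map_shift _ i n k l id (fun _ _ => erefl).
have -> : [seq i (shift_fun k id j) | j <- iota 0 (k + (n + l))] =
    [seq i j | j <- iota 0 (k + (n + l))].
  by apply: eq_map => j; rewrite /shift_fun; case: ltnP => // /subnKC ->.
move=> ->; apply: interchangeable_cat; exact: (Fn (fun j => i (k + j)%N)).
Qed.

Hypothesis qq : q *m q = q.
Hypothesis trq : \tr q = 1.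

(** At an even place the inserted pair is a diagonal entry of q, and the sum is the
    trace; at an odd place it joins two neighbouring entries of q, and the sum is
    an entry of q^2. *)
Lemma seq_word_insert x y : \sum_c seq_word (x ++ [:: c, c & y]) = seq_word (x ++ y).
Proof.
elim/pair_ind: x => [|a|a b x IHx] /=.
- by rewrite -mulr_suml -/(mxtrace q) trq mul1r.
- case: y => [|b y] /=; first by apply: big1 => c _; rewrite mulr0.
  under eq_bigr do rewrite mulrA.
  by rewrite -mulr_suml -[in RHS]qq mxE.
- by rewrite -mulr_sumr IHx.
Qed.

(** The pair of equal letters may sit at different places of the two blocks, which
    is what makes the 3-cycles below collapse to transpositions. *)
Lemma interchangeable_contract u1 u2 v1 v2 :
  (forall c, interchangeable (u1 ++ [:: c; c] ++ u2) (v1 ++ [:: c; c] ++ v2)) ->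
  interchangeable (u1 ++ u2) (v1 ++ v2).
Proof.
move=> uv x y; rewrite -!catA !(catA x) -!seq_word_insert.
by apply: eq_bigr => c _; have := uv c x y; rewrite -!catA !(catA x).
Qed.

(** The letter c of the blocks also serves as second letter of an inserted pair. *)
Lemma interchangeable_behead u v :
  (forall c, interchangeable (c :: u) (c :: v)) -> interchangeable u v.
Proof.
move=> uv; apply: (@interchangeable_contract [::] u [::] v) => c.
by have := @interchangeable_cat [:: c] [::] _ _ (uv c); rewrite !cats0.
Qed.

Lemma interchangeable_belast u v :
  (forall c, interchangeable (rcons u c) (rcons v c)) -> interchangeable u v.
Proof.
move=> uv; rewrite -[u]cats0 -[v]cats0; apply: interchangeable_contract => c.
by have := @interchangeable_cat [::] [:: c] _ _ (uv c); rewrite !cat_rcons.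
Qed.

Lemma interchangeable_trim k l u v :
  (forall x y, size x = k -> size y = l ->
     interchangeable (x ++ u ++ y) (x ++ v ++ y)) ->
  interchangeable u v.
Proof.
elim: k l u v => [|k IHk] l u v.
  elim: l u v => [|l IHl] u v uv.
    by have := uv [::] [::] erefl erefl; rewrite !cats0.
  apply: interchangeable_belast => c; apply: IHl => x y szx szy.
  by rewrite !cat_rcons; apply: uv; rewrite //= szy.
move=> uv; apply: interchangeable_behead => c; apply: (IHk l) => x y szx szy.
by have := uv (rcons x c) y; rewrite size_rcons szx !cat_rcons; apply.
Qed.

End Words.

(** * From a nontrivial permutation to transpositions of equal parity *)

(** Two permutations, one moving only places up to M and the other only places from
    M on, have a 3-cycle as commutator. *)
Lemma commutator_one_common_point (M : nat) (F F' G G' : nat -> nat) :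
    cancel F F' -> cancel F' F -> cancel G G' -> cancel G' G ->
    (forall j, (M < j)%N -> F j = j) -> (forall j, (j < M)%N -> G j = j) ->
    (F M < M)%N -> (M < G M)%N ->
  let C := F \o G \o F' \o G' in
  [/\ C (F M) = G M, C M = F M, C (G M) = M &
      forall j, j != F M -> j != M -> j != G M -> C j = j].
Proof.
move=> FK F'K GK G'K Fid Gid FM GM C.
have F'id j : (M < j)%N -> F' j = j by move=> /Fid {1}<-; rewrite FK.
have G'id j : (j < M)%N -> G' j = j by move=> /Gid {1}<-; rewrite GK.
have G'lt j : j != G M -> (M < j)%N -> (M < G' j)%N.
  move=> jGM Mj; rewrite ltnNge leq_eqVlt; apply/negP => /predU1P[e | lt].
    by move: jGM; rewrite -e G'K eqxx.
  by have := Gid _ lt; rewrite G'K; lia.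
have F'lt j : j != F M -> (j < M)%N -> (F' j < M)%N.
  move=> jFM jM; rewrite ltnNge leq_eqVlt; apply/negP => /predU1P[e | lt].
    by move: jFM; rewrite e F'K eqxx.
  by have := Fid _ lt; rewrite F'K; lia.
rewrite /C /=; split.
- by rewrite (G'id _ FM) FK Fid.
- have G'M : (M < G' M)%N.
    rewrite ltnNge leq_eqVlt; apply/negP => /predU1P[e | lt].
      by move: GM; rewrite -{2}e G'K; lia.
    by have := Gid _ lt; rewrite G'K; lia.
  by rewrite (F'id _ G'M) G'K.
- rewrite GK; have F'M : (F' M < M)%N.
    rewrite ltnNge leq_eqVlt; apply/negP => /predU1P[e | lt].
      by move: FM; rewrite {1}e F'K; lia.
    by have := Fid _ lt; rewrite F'K; lia.
  by rewrite (Gid _ F'M) F'K.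
- move=> j jFM jM jGM; case: (ltngtP j M) => [ltjM|ltMj|/eqP]; last by rewrite (negPf jM).
    by rewrite (G'id _ ltjM) (Gid _ (F'lt _ jFM ltjM)) F'K.
  by rewrite (F'id _ (G'lt _ jGM ltMj)) G'K Fid.
Qed.

Lemma iota_split k m n : (k <= m < n)%N ->
  iota k (n - k) = iota k (m - k) ++ m :: iota m.+1 (n - m.+1).
Proof.
move=> kmn; have -> : (n - k = (m - k) + (n - m.+1).+1)%N by lia.
by rewrite iotaD subnKC //; lia.
Qed.

Section ThreeCycles.
Context (Q : pzRingType) (N : nat) (q : 'M[Q]_N).
Implicit Types (u v x y ys zs : seq 'I_N).
Hypothesis qq : q *m q = q.
Hypothesis trq : \tr q = 1.
Local Notation interchangeable := (interchangeable q).
Local Notation is_allowed := (is_allowed q).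

(** The 3-cycle of three letters separated by blocks of d and e letters. *)
Definition cycle_exchange d e := forall a b m ys zs, size ys = d -> size zs = e ->
  interchangeable (a :: ys ++ m :: zs ++ [:: b]) (b :: ys ++ a :: zs ++ [:: m]).

(** The letters outside the three places and the two gaps are the same on both
    sides and are removed by [interchangeable_trim]. *)
Lemma cycle_exchange_of_allowed (C : nat -> nat) A M B K :
    is_allowed K C -> (A < M)%N -> (M < B)%N -> (B < K)%N ->
    C A = B -> C M = A -> C B = M ->
    (forall j, j != A -> j != M -> j != B -> C j = j) ->
  cycle_exchange (M - A.+1) (B - M.+1).
Proof.
move=> allC AM MB BK CA CM CB Cid a b m ys zs sz_ys sz_zs.
apply: (interchangeable_trim qq trq (k := A) (l := (K - B.+1)%N)) => x y szx szy.
pose i := nth a (x ++ a :: ys ++ m :: zs ++ b :: y).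
have splitK : iota 0 K = iota 0 A ++ A :: iota A.+1 (M - A.+1) ++
    M :: iota M.+1 (B - M.+1) ++ B :: iota B.+1 (K - B.+1).
  rewrite -[K in LHS]subn0 (@iota_split 0 A K) ?subn0; last by lia.
  rewrite (@iota_split A.+1 M K); last by lia.
  by rewrite (@iota_split M.+1 B K); last by lia.
have iL : [seq i j | j <- iota 0 K] = x ++ a :: ys ++ m :: zs ++ b :: y.
  have sizeL : size (x ++ a :: ys ++ m :: zs ++ b :: y) = K.
    by do 3! rewrite size_cat /=; rewrite szx szy sz_ys sz_zs; lia.
  by rewrite map_nth_iota0 ?take_oversize ?sizeL.
have : [/\ map i (iota 0 A) = x, i A = a, map i (iota A.+1 (M - A.+1)) = ys,
    i M = m & [/\ map i (iota M.+1 (B - M.+1)) = zs, i B = b &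
                 map i (iota B.+1 (K - B.+1)) = y]].
  move/eqP: iL; rewrite splitK !(map_cat, map_cons).
  rewrite eqseq_cat ?size_map ?size_iota // => /andP[/eqP ix].
  rewrite eqseq_cons => /andP[/eqP iA].
  rewrite eqseq_cat ?size_map ?size_iota // => /andP[/eqP iys].
  rewrite eqseq_cons => /andP[/eqP im].
  rewrite eqseq_cat ?size_map ?size_iota // => /andP[/eqP izs].
  by rewrite eqseq_cons => /andP[/eqP ib /eqP iy].
case=> ix iA iys iM [izs iB iy].
have := allC i; rewrite iL splitK !(map_cat, map_cons) CA CM CB iA iM iB.
have fixed k n : (forall j, k <= j < k + n -> j != A /\ j != M /\ j != B)%N ->
    [seq i (C j) | j <- iota k n] = map i (iota k n).
  move=> ne; apply/eq_in_map => j; rewrite mem_iota => /ne[jA [jM jB]].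
  by rewrite Cid.
rewrite !fixed ?ix ?iys ?izs ?iy; try by [move=> j; lia].
by rewrite /= -!catA /= -!catA.
Qed.

Lemma cycle_exchange_shrink d e : cycle_exchange d e -> cycle_exchange (odd d) (odd e).
Proof.
have shrinkl d' e' : cycle_exchange d'.+2 e' -> cycle_exchange d' e'.
  move=> ex a b m ys zs szy szz.
  apply: (interchangeable_contract qq trq (u1 := [:: a]) (v1 := [:: b])) => c.
  by apply: (ex a b m [:: c, c & ys] zs) => //=; rewrite szy.
have shrinkr d' e' : cycle_exchange d' e'.+2 -> cycle_exchange d' e'.
  move=> ex a b m ys zs szy szz.
  have := @interchangeable_contract _ _ _ qq trq (a :: ys ++ [:: m]) (zs ++ [:: b])
    (b :: ys ++ [:: a]) (zs ++ [:: m]); rewrite /= -!catA; apply=> c.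
  by rewrite /= -!catA; apply: (ex a b m ys [:: c, c & zs]) => //=; rewrite szz.
rewrite -{1}(odd_double_half d) -{1}(odd_double_half e).
elim: d./2 => [|n IHn].
  elim: e./2 => [|n IHn]; first by rewrite !addn0.
  by rewrite doubleS !addnS => /shrinkr.
by rewrite doubleS !addnS => /shrinkl.
Qed.

Definition parity_swaps := forall a c b, interchangeable [:: a; c; b] [:: b; c; a].

Lemma parity_swaps_of_swaps :
  (forall a b, interchangeable [:: a; b] [:: b; a]) -> parity_swaps.
Proof.
move=> swap a y b.
apply: (@interchangeable_trans _ _ _ [:: y; a; b]).
  exact: (interchangeable_cat [::] [:: b] (swap a y)).
apply: (@interchangeable_trans _ _ _ [:: y; b; a]).
  exact: (interchangeable_cat [:: y] [::] (swap a b)).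
exact: (interchangeable_cat [::] [:: a] (swap y b)).
Qed.

(** Case analysis on the number of letters, 0 or 1, in the two gaps.  If a gap has
    one letter, then some pair of letters is adjacent both before and after the
    3-cycle, and erasing it leaves a transposition.  If both gaps are empty, the
    3-cycles generate the even permutations, among them the double transposition
    abcd -> badc, from which the pair c = d is erased. *)
Lemma parity_swaps_of_cycle d e : cycle_exchange d e -> parity_swaps.
Proof.
move/cycle_exchange_shrink; case: (odd d); case: (odd e) => ex.
- move=> a y b; have := @interchangeable_contract _ _ _ qq trq [::] [:: a; y; b]
    [:: b] [:: y; a]; apply=> c.
  exact: (ex c b a [:: c] [:: y]).
- apply: parity_swaps_of_swaps => a b.
  have := @interchangeable_contract _ _ _ qq trq [::] [:: a; b] [:: b] [:: a].
  by apply=> c; apply: (ex c b a [:: c] [::]).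
- apply: parity_swaps_of_swaps => a b.
  have := @interchangeable_contract _ _ _ qq trq [:: a] [:: b] [:: b; a] [::].
  by apply=> c; apply: (ex a b c [::] [:: c]).
- apply: parity_swaps_of_swaps => a b.
  have cyc a' b' c' : interchangeable [:: a'; b'; c'] [:: c'; a'; b'].
    exact: (ex a' c' b' [::] [::]).
  have := @interchangeable_contract _ _ _ qq trq [:: a; b] [::] [:: b; a] [::].
  apply=> c /=.
  (* abcc -> bcac -> bacc, each step being the inverse of a 3-cycle *)
  apply: (@interchangeable_trans _ _ _ [:: b; c; a; c]).
    apply: interchangeable_sym.
    exact: (interchangeable_cat [::] [:: c] (cyc b c a)).
  apply: interchangeable_sym.
  exact: (interchangeable_cat [:: b] [::] (cyc a c c)).
Qed.

End ThreeCycles.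

(** * Relations of a permutation and of its bars *)
Definition perm_fun n (s : 'S_n) (j : nat) : nat :=
  if insub j is Some k then s k else j.

Lemma perm_fun_ord n (s : 'S_n) (k : 'I_n) : perm_fun s k = s k.
Proof. by rewrite /perm_fun valK. Qed.

Lemma perm_fun_id n (s : 'S_n) j : (n <= j)%N -> perm_fun s j = j.
Proof. by rewrite leqNgt /perm_fun => jn; rewrite insubN. Qed.

Lemma perm_funK n (s : 'S_n) : cancel (perm_fun s) (perm_fun s^-1).
Proof.
move=> j; have [jn | nj] := ltnP j n; last by rewrite !perm_fun_id.
by rewrite -[j]/(val (Ordinal jn)) !perm_fun_ord permK.
Qed.

Lemma perm_fun_bars m (s : 'S_m.*2) : perm_fun (bars s) =1 shift_fun 1 (perm_fun s).
Proof.
move=> j; have [ltj | gej] := ltnP j m.+1.*2; last first.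
  rewrite /shift_fun !perm_fun_id //; last by move: gej; rewrite doubleS; lia.
  by move: gej; rewrite doubleS; case: j => // j _; rewrite subn1.
rewrite -[j]/(val (Ordinal ltj)) perm_fun_ord; move: (Ordinal _) => {ltj}k.
rewrite /bars /shift_fun; case: (unliftP ord0 k) => [k' ->|->]; last first.
  by rewrite lift_perm_id.
rewrite lift_perm_lift !lift0 /= subn1 /=; congr _.+1.
case: (unliftP ord_max k') => [h ->|->]; last by rewrite lift_perm_id /= perm_fun_id.
by rewrite lift_perm_lift !lift_max perm_fun_ord.
Qed.

Fixpoint iter_bars m (s : 'S_m.*2) k : 'S_(k + m).*2 :=
  if k is k'.+1 then bars (iter_bars s k') else s.

Lemma perm_fun_iter_bars m (s : 'S_m.*2) k :
  perm_fun (iter_bars s k) =1 shift_fun k (perm_fun s).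
Proof.
elim: k => [|k IHk] j; first by rewrite /shift_fun subn0.
rewrite perm_fun_bars /shift_fun; case: j => // j; rewrite subn1 /= IHk /shift_fun.
by rewrite ltnS; case: ltnP.
Qed.

Definition perm_word (Q : pzRingType) N (q : 'M[Q]_N) m (i : 'I_m.*2 -> 'I_N) :=
  \prod_(j < m) q (i (left_pos j)) (i (right_pos j)).

Section Relations.
Context (Q : pzRingType) (N : nat) (q : 'M[Q]_N).
Local Notation interchangeable := (interchangeable q).
Local Notation is_allowed := (is_allowed q).

Lemma perm_word_seq m (f : nat -> 'I_N) (i : 'I_m.*2 -> 'I_N) :
  i =1 f \o val -> perm_word q i = seq_word q [seq f j | j <- iota 0 m.*2].
Proof.
move=> i_f; rewrite /perm_word; under eq_bigr do rewrite !i_f /=.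
elim: m f {i i_f} => [|m IHm] f; first by rewrite big_ord0.
rewrite big_ord_recl doubleS /=; congr (_ * _).
rewrite -[2%N]/(2 + 0)%N iotaDl -map_comp -IHm.
by apply: eq_bigr => j _; rewrite /= /bump /=; congr (q (f _) (f _)); lia.
Qed.

Context (m : nat) (s : 'S_m.*2).
Hypothesis relations : forall k (i : 'I_(k + m).*2 -> 'I_N),
  perm_word q i = perm_word q (i \o iter_bars s k).

(** The relation of s with k bars on both sides, the bars carrying the context. *)
Lemma balanced_context k f (x y : seq 'I_N) : size x = k -> size y = k ->
  seq_word q (x ++ [seq f j | j <- iota 0 m.*2] ++ y) =
  seq_word q (x ++ [seq f (perm_fun s j) | j <- iota 0 m.*2] ++ y).
Proof.
move=> szx szy; pose u := [seq f j | j <- iota 0 m.*2].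
have szu : size u = m.*2 by rewrite size_map size_iota.
pose g := nth (f 0%N) (x ++ u ++ y).
have szL : size (x ++ u ++ y) = (k + m).*2.
  by rewrite !size_cat szx szy szu; lia.
have -> : x ++ u ++ y = [seq g j | j <- iota 0 (k + m).*2].
  by rewrite map_nth_iota0 ?take_oversize ?szL.
pose i (j : 'I_(k + m).*2) := g j.
rewrite -(@perm_word_seq _ g i) // relations.
rewrite (@perm_word_seq _ (g \o shift_fun k (perm_fun s))); last first.
  by move=> j /=; rewrite -perm_fun_iter_bars perm_fun_ord.
rewrite (_ : (k + m).*2 = k + (m.*2 + k))%N; last by lia.
have pfid j : (m.*2 <= j)%N -> perm_fun s j = j by apply: perm_fun_id.
rewrite (map_shift g k k pfid); congr (seq_word q (_ ++ _ ++ _)).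
- rewrite map_nth_iota0 ?size_cat ?szx ?leq_addr //.
  by rewrite take_cat szx ltnn subnn take0 cats0.
- apply/eq_in_map => j; rewrite mem_iota /= => jm.
  rewrite /g nth_cat szx ltnNge leq_addr /= addKn nth_cat szu.
  have lt_s : (perm_fun s j < m.*2)%N.
    by rewrite -[j]/(val (Ordinal jm)) perm_fun_ord.
  by rewrite lt_s (nth_map 0%N) ?size_iota // nth_iota.
- rewrite map_nth_iota ?szL; last by lia.
  rewrite catA drop_size_cat ?size_cat ?szx ?szu //.
  by rewrite -szy take_size.
Qed.

(** If the contexts have different lengths of the same parity, the excess of the
    longer one has even length and splits off as a factor. *)
Lemma perm_fun_allowed : is_allowed m.*2 (perm_fun s).
Proof.
move=> f x y.
set u := [seq f j | j <- _]; set v := [seq _ | j <- _].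
have [szu szv] : size u = m.*2 /\ size v = m.*2 by rewrite !size_map !size_iota.
have [odd_xy | even_xy] := boolP (odd (size x + size y)).
  by rewrite !seq_word_odd // !size_cat ?szu ?szv; lia.
have [le_xy | lt_yx] := leqP (size x) (size y).
  rewrite -(cat_take_drop (size x) y) (catA u) (catA v) (catA x (u ++ _)) (catA x (v ++ _)).
  have sz1 : size (take (size x) y) = size x by rewrite size_take_min; lia.
  rewrite !(@seq_word_cat _ _ _ (x ++ _)).
  - by rewrite (balanced_context f (erefl (size x)) sz1).
  - by rewrite !size_cat szv sz1; lia.
  - by rewrite !size_cat szu sz1; lia.
rewrite -(cat_take_drop (size x - size y) x) -!catA.
have sz1 : size (drop (size x - size y) x) = size y by rewrite size_drop; lia.
rewrite !(@seq_word_cat _ _ _ (take _ _)); first by rewrite (balanced_context f sz1 erefl).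
all: by rewrite size_take_min; lia.
Qed.

Hypothesis qq : q *m q = q.
Hypothesis trq : \tr q = 1.

(** Here c and M are the first and last places moved by s; the shift by M - c makes
    M the only place moved by both permutations. *)
Lemma parity_swaps_of_relations : s != 1%g -> parity_swaps q.
Proof.
move=> s_neq1; pose F := perm_fun s; pose F' := perm_fun s^-1.
have FK : cancel F F' by apply: perm_funK.
have F'K : cancel F' F by rewrite /F -[s]invgK; apply: perm_funK.
have Fid j : (m.*2 <= j)%N -> F j = j by apply: perm_fun_id.
have exF : exists j, F j != j.
  have /existsP[k sk] : [exists k, s k != k].
    apply: contraR s_neq1; rewrite negb_exists => /forallP s_id.
    by apply/eqP/permP=> k; rewrite perm1; apply/eqP; rewrite -[_ == _]negbK.
  by exists k; rewrite /F perm_fun_ord.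
have leF j : F j != j -> (j <= m.*2)%N.
  by apply: contraR; rewrite -ltnNge => /ltnW /Fid ->.
case: (ex_minnP exF) => c Fc c_min; case: (ex_maxnP exF leF) => M FM M_max.
have F_below j : (j < c)%N -> F j = j.
  by move=> jc; apply/eqP; apply: contraLR jc => /c_min; rewrite -leqNgt.
have F_above j : (M < j)%N -> F j = j.
  by move=> Mj; apply/eqP; apply: contraLR Mj => /M_max; rewrite -leqNgt.
have FMlt : (F M < M)%N.
  rewrite ltn_neqAle FM leqNgt; apply/negP => /F_above /(can_inj FK) FMM.
  by rewrite FMM eqxx in FM.
have Fcgt : (c < F c)%N.
  rewrite ltn_neqAle eq_sym Fc leqNgt; apply/negP => /F_below /(can_inj FK) Fcc.
  by rewrite Fcc eqxx in Fc.
have Fc_lt : (F c < m.*2)%N.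
  rewrite ltnNge; apply/negP => /Fid /(can_inj FK) Fcc.
  by rewrite Fcc eqxx in Fc.
have le_cM : (c <= M)%N by apply: c_min.
have K_eq : (M - c + (m.*2 + 0) = 0 + (m.*2 + (M - c)))%N by lia.
have shiftK k H H' : cancel H H' -> cancel (shift_fun k H) (shift_fun k H').
  move=> HK j; rewrite /shift_fun; case: (ltnP j k) => [-> // | kj].
  by rewrite ltnNge leq_addr /= addKn HK subnKC.
have allF := is_allowed_shift 0 (M - c) Fid perm_fun_allowed.
have allG := is_allowed_shift (M - c) 0 Fid perm_fun_allowed.
rewrite K_eq in allG.
have F0 H : shift_fun 0 H =1 H by move=> j; rewrite /shift_fun /= subn0.
have [] := @commutator_one_common_point M (shift_fun 0 F) (shift_fun 0 F')
  (shift_fun (M - c) F) (shift_fun (M - c) F')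
  (shiftK _ _ _ FK) (shiftK _ _ _ F'K) (shiftK _ _ _ FK) (shiftK _ _ _ F'K).
- by move=> j; rewrite F0; apply: F_above.
- move=> j jM; rewrite /shift_fun; case: ltnP => // kj.
  by rewrite F_below ?subnKC //; lia.
- by rewrite F0.
- by rewrite /shift_fun [(M < M - c)%N]ltnNge leq_subr /= subKn //; lia.
move=> CA CM CB Cid.
have allC := is_allowed_comp allF (is_allowed_comp allG (is_allowed_comp
   (is_allowed_inv (shiftK _ _ _ FK) allF) (is_allowed_inv (shiftK _ _ _ FK) allG))).
apply: (parity_swaps_of_cycle qq trq
  (cycle_exchange_of_allowed qq trq allC _ _ _ CA CM CB Cid)).
- by rewrite F0.
- by rewrite /shift_fun [(M < M - c)%N]ltnNge leq_subr /= subKn //; lia.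
- by rewrite /shift_fun [(M < M - c)%N]ltnNge leq_subr /= subKn //; lia.
Qed.

Lemma parity_swaps_commute : parity_swaps q ->
  forall a b c d, q a b * q c d = q c d * q a b.
Proof.
move=> swaps a b c d.
have := swaps a b c [::] [:: d]; have := swaps b a d [:: c] [::].
by rewrite /= !mulr1 => <- ->.
Qed.

Lemma parity_swaps_rank_one : parity_swaps q ->
  forall a b c d, q a b * q c d = q a d * q c b.
Proof. by move=> swaps a b c d; have := swaps b c d [:: a] [::]; rewrite /= !mulr1. Qed.

End Relations.

(** * Words over a commutative ring *)
Definition half_pos m (b : bool) (j : 'I_m) := if b then right_pos j else left_pos j.

Lemma half_pos_eq m b c (j k : 'I_m) :
  (half_pos b j == half_pos c k) = (b == c) && (j == k).
Proof. by rewrite -!val_eqE; case: b; case: c => /=; lia. Qed.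

Lemma half_posP m (x : 'I_m.*2) : exists j, x = half_pos (odd x) j.
Proof.
have xm : (x./2 < m)%N by have := ltn_ord x; lia.
exists (Ordinal xm); apply: val_inj.
by rewrite /half_pos; case: ifP => /= x_odd; lia.
Qed.

Section RankOne.
Context (C : comPzRingType) (N : nat) (p : 'M[C]_N).
Hypothesis rank_one : forall a b c d, p a b * p c d = p a d * p c b.

(** In a product p_ab p_cd the relation of rank one exchanges b and d, hence also a
    and c by commutativity; with symmetry every exchange is possible. *)
Lemma perm_word_tperm m (i : 'I_m.*2 -> 'I_N) (x y : 'I_m.*2) :
    odd x = odd y \/ (forall a b, p a b = p b a) ->
  perm_word p (i \o tperm x y) = perm_word p i.
Proof.
move=> parity.
have [j xj] := half_posP x; have [k yk] := half_posP y.
move: (odd x) (odd y) xj yk parity => b c -> -> parity {x y}.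
pose i' := i \o tperm (half_pos b j) (half_pos c k).
have i'E d l : i' (half_pos d l) =
    if (d == b) && (l == j) then i (half_pos c k)
    else if (d == c) && (l == k) then i (half_pos b j) else i (half_pos d l).
  by rewrite /i' /= permE /= !half_pos_eq; case: ifP => // _; case: ifP.
rewrite -/i' /perm_word.
pose w (f : 'I_m.*2 -> 'I_N) l := p (f (half_pos false l)) (f (half_pos true l)).
suff: \prod_(l < m) w i' l = \prod_(l < m) w i l by [].
have fixed l : l != j -> l != k -> w i' l = w i l.
  by move=> /negPf lj /negPf lk; rewrite /w !i'E lj lk !andbF.
have [jk | jk] := eqVneq j k.
  rewrite -jk in i'E fixed *; rewrite (bigD1 j) //= [RHS](bigD1 j) //=.
  congr (_ * _); last by apply: eq_bigr => l lj; apply: fixed.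
  rewrite /w !i'E eqxx !andbT; case: b c parity {i' i'E fixed} => [] [] // [] //.
rewrite (bigD1 j) //= (bigD1 k) 1?eq_sym //= [RHS](bigD1 j) //=.
rewrite [in RHS](bigD1 k) 1?eq_sym //= !mulrA; congr (_ * _); last first.
  by apply: eq_bigr => l /andP[lj lk]; apply: fixed.
rewrite /w !i'E !eqxx (eq_sym k j) (negPf jk) !andbT !andbF.
case: parity => [<-|sym].
  by case: b {i' i'E fixed} => /=; rewrite rank_one; last rewrite mulrC.
case: b {i' i'E fixed}; case: c => /=.
- by rewrite rank_one.
- by rewrite (sym (i (left_pos k))) [RHS]rank_one (sym (i (right_pos k)) (i (right_pos j))).
- by rewrite (sym (i (left_pos j))) [RHS]rank_one (sym (i (right_pos j)) (i (right_pos k))).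
- by rewrite rank_one mulrC.
Qed.

(** Induction on the number of moved places: composing s with the transposition of
    s x and x fixes one more place, and preserves parity if s does. *)
Lemma perm_word_perm m (s : 'S_m.*2) (i : 'I_m.*2 -> 'I_N) :
    (forall x, odd (s x) = odd x) \/ (forall a b, p a b = p b a) ->
  perm_word p (i \o s) = perm_word p i.
Proof.
have [n] := ubnP #|[pred x | s x != x]|.
elim: n s i => // n IHn s i lt_n parity.
have [/existsP[x sx] | ] := boolP [exists x, s x != x]; last first.
  rewrite negb_exists => /forallP s_id; apply: eq_bigr => j _ /=.
  by congr (p (i _) (i _)); apply/eqP; rewrite -[_ == _]negbK.
pose s' := (s * tperm (s x) x)%g.
have s'E y : s' y = tperm (s x) x (s y) by rewrite permM.
have sE y : s y = tperm (s x) x (s' y) by rewrite s'E tpermK.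
have -> : perm_word p (i \o s) = perm_word p ((i \o tperm (s x) x) \o s').
  by apply: eq_bigr => j _ /=; rewrite -!sE.
have parity_t : odd (s x) = odd x \/ (forall a b, p a b = p b a).
  by case: parity => [/(_ x)|]; [left | right].
rewrite IHn; first exact: perm_word_tperm.
- rewrite -ltnS; apply: leq_trans lt_n; rewrite ltnS; apply: proper_card.
  apply/properP; split; last first.
    by exists x; rewrite inE // s'E tpermL eqxx.
  apply/fintype.subsetP=> y; rewrite !inE; apply: contra => /eqP sy.
  have [yx|yx] := eqVneq y x; first by rewrite -yx sy eqxx in sx.
  have sxy : s x != y by rewrite -sy (inj_eq perm_inj) eq_sym.
  by rewrite s'E sy tpermD // eq_sym.
- case: parity => [odd_s|]; [left=> y | by right].
  by rewrite s'E; case: tpermP => [e|e|_ _]; rewrite -(odd_s y) ?e ?odd_s.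
Qed.

Hypothesis trp : \tr p = 1.

(** The elements a power of which kills x are closed under addition, by the binomial
    formula. *)
Lemma torsion_of_sum1 (I : finType) (t : I -> C) n x :
  \sum_c t c = 1 -> (forall c, t c ^+ n * x = 0) -> x = 0.
Proof.
move=> sum1 tx; suff [k] : exists k, (\sum_c t c) ^+ k * x = 0.
  by rewrite sum1 expr1n mul1r.
apply: (big_ind (fun u => exists k, u ^+ k * x = 0)).
- by exists 1; rewrite expr1 mul0r.
- move=> u v [k uk] [l vl]; exists (k + l)%N.
  rewrite exprDn mulr_suml big1 // => j _; rewrite mulrnAl.
  have [le_lj | lt_jl] := leqP l j.
    by rewrite -(subnK le_lj) exprD -!mulrA vl !mulr0 mul0rn.
  have -> : (k + l - j = (l - j) + k)%N by lia.
  rewrite exprD (_ : _ * x = u ^+ (l - j) * v ^+ j * (u ^+ k * x)); last by ring.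
  by rewrite uk mulr0 mul0rn.
- by move=> c _; exists n.
Qed.

Lemma perm_word_one_letter m (z : 'I_m.*2) b c :
  perm_word p (fun y => if y == z then b else c) =
  (if odd z then p c b else p b c) * p c c ^+ m.-1.
Proof.
have [j zj] := half_posP z; move: (odd z) zj => e -> {z}.
pose f (y : 'I_m.*2) := if y == half_pos e j then b else c.
suff: \prod_(l < m) p (f (half_pos false l)) (f (half_pos true l)) =
    (if e then p c b else p b c) * p c c ^+ m.-1 by [].
under eq_bigr do rewrite /f !half_pos_eq.
rewrite (bigD1 j) //= eqxx !andbT; congr (_ * _); first by case: e {f}.
rewrite (eq_bigr (fun=> p c c)) => [|l /negPf ->]; last by rewrite !andbF.
rewrite (eq_bigl (mem (predC1 j))) => [|l]; last by rewrite !inE.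
by rewrite prodr_const cardC1 card_ord.
Qed.

(** Let all letters be c except a letter d at the place s x.  Both sides of the
    relation are then p_cc^(m-1) times p_cd or p_dc according to the parity of the
    place of d, so a parity break gives p_cc^(m-1) (p_cd - p_dc) = 0.  By rank one,
    p_cc (p_ab - p_ba) is a combination of such differences, hence is killed by the
    same power of p_cc, and the p_cc have sum 1. *)
Lemma symmetric_of_parity_break m (s : 'S_m.*2) x :
    (forall i, perm_word p i = perm_word p (i \o s)) -> odd (s x) != odd x ->
  forall a b, p a b = p b a.
Proof.
move=> rel odd_sx a b.
have asym0 c d : p c c ^+ m.-1 * (p c d - p d c) = 0.
  have := rel (fun y => if y == s x then d else c).
  rewrite perm_word_one_letter.
  have -> : perm_word p ((fun y => if y == s x then d else c) \o s) =
      perm_word p (fun y => if y == x then d else c).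
    by apply: eq_bigr => j _ /=; rewrite !(inj_eq perm_inj).
  rewrite perm_word_one_letter mulrBr ![p c c ^+ _ * _]mulrC.
  by case: (odd (s x)) (odd x) odd_sx => [] [] // _ ->; rewrite subrr.
apply/subr0_eq/(@torsion_of_sum1 _ (fun c => p c c) m.-1.+1 _ trp) => c.
rewrite exprSr -mulrA mulrBr (rank_one c c a b) (rank_one c c b a).
have -> : p c b * p a c - p c a * p b c =
    (p c b - p b c) * p c a - (p c a - p a c) * p c b by ring.
by rewrite mulrBr !mulrA !asym0 !mul0r subrr.
Qed.

End RankOne.

(** * Relations modulo an ideal *)
Section Ideals.
Context (A : pzRingType) (N : nat) (p : 'M[A]_N) (J : set A).
Hypothesis pp : p *m p = p.
Hypothesis trp : \tr p = 1.
Hypothesis idealJ : is_ideal J.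

Lemma rmorph_perm_word (B D : pzRingType) (f : {rmorphism B -> D})
    (r : 'M[B]_N) m (i : 'I_m.*2 -> 'I_N) :
  f (perm_word r i) = perm_word (map_mx f r) i.
Proof. by rewrite rmorph_prod; apply: eq_bigr => j _; rewrite mxE. Qed.

(** Nontrivial quotients suffice: an ideal containing 1 contains everything. *)
Lemma in_ideal_by_quotient x :
  (forall (Q : nzRingType) (f : {rmorphism A -> Q}),
     (forall y, f y = 0 <-> J y) -> f x = 0) -> J x.
Proof.
move=> fx0; have [J1 | J1] := pselect (J 1).
  by rewrite -[x]mulr1; apply: idealMl.
have [Q [f fP]] := exists_quotient_ring idealJ J1.
exact/fP/fx0.
Qed.

Lemma exists_commutative_matrix (Q : nzRingType) (q : 'M[Q]_N) :
    (forall i j k l, q i j * q k l = q k l * q i j) ->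
  exists (C : comNzRingType) (f : {rmorphism C -> Q}) (c : 'M[C]_N),
    injective f /\ map_mx f c = q.
Proof.
move=> q_comm.
have [|C [f [f_inj [c cq]]]] := @exists_commutative_subring Q _ (fun ij => q ij.1 ij.2).
  by move=> [i j] [k l]; apply: q_comm.
exists C, f, (\matrix_(i, j) c (i, j)); split=> //.
by apply/matrixP=> i j; rewrite !mxE cq.
Qed.

(** The relations of the complex and real projective spaces imply those of the
    permutations: the coordinates modulo J are lifted to a commutative ring, where
    the invertibility of the positive integers becomes the absence of torsion. *)
Lemma ideal_perm_relations m (s : 'S_m.*2) :
    (forall n, exists u : A, u * n.+1%:R = 1) ->
    (forall i j k l, J (p i j * p k l - p k l * p i j)) ->
    (forall x, odd (s x) = odd x) \/ (forall a b, J (p a b - p b a)) ->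
  forall i, J (perm_word p i - perm_word p (i \o s)).
Proof.
move=> natV comm parity i; apply: in_ideal_by_quotient => Q f fP.
have feq x y : J (x - y) -> f x = f y by move=> /fP; rewrite rmorphB => /subr0_eq.
have [|C [g [c [g_inj gc]]]] := @exists_commutative_matrix Q (map_mx f p).
  by move=> i1 j k l; rewrite !mxE -!rmorphM; apply: feq.
have gcE a b : g (c a b) = f (p a b) by move/matrixP: gc => /(_ a b); rewrite !mxE.
have cc : c *m c = c.
  apply/matrixP=> a b; apply: g_inj.
  have: map_mx g (c *m c) = map_mx g c by rewrite map_mxM gc -map_mxM pp.
  by move/matrixP => /(_ a b); rewrite !mxE.
have trc : \tr c = 1.
  by apply: g_inj; rewrite -trace_map_mx gc trace_map_mx trp !rmorph1.
have torsion_free n (x : C) : n.+1%:R * x = 0 -> x = 0.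
  have [u un] := natV n; move=> /(congr1 g); rewrite rmorphM rmorph_nat rmorph0 => nx.
  apply: g_inj; rewrite rmorph0 -[g x]mul1r -(rmorph1 f) -un rmorphM rmorph_nat.
  by rewrite -mulrA nx mulr0.
apply/eqP; rewrite rmorphB subr_eq0 !rmorph_perm_word -gc -!rmorph_perm_word.
apply/eqP; congr (g _); symmetry; apply: perm_word_perm.
  exact: rank_one_minors torsion_free cc trc.
case: parity => [|sym]; [by left | right=> a b].
by apply: g_inj; rewrite !gcE; apply: feq.
Qed.

Context (m : nat) (s : 'S_m.*2).
Hypothesis relations : forall k (i : 'I_(k + m).*2 -> 'I_N),
  J (perm_word p i - perm_word p (i \o iter_bars s k)).

Lemma quotient_parity_swaps (Q : nzRingType) (f : {rmorphism A -> Q}) :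
  (forall y, f y = 0 <-> J y) -> s != 1%g -> parity_swaps (map_mx f p).
Proof.
move=> fP; apply: parity_swaps_of_relations.
- move=> k i; rewrite -!rmorph_perm_word; apply/eqP.
  by rewrite -subr_eq0 -rmorphB; apply/eqP/fP.
- by rewrite -map_mxM pp.
- by rewrite trace_map_mx trp rmorph1.
Qed.

Lemma ideal_commutators : s != 1%g ->
  forall i j k l, J (p i j * p k l - p k l * p i j).
Proof.
move=> s1 i j k l; apply: in_ideal_by_quotient => Q f fP.
have := parity_swaps_commute (quotient_parity_swaps fP s1) i j k l.
by rewrite !mxE rmorphB !rmorphM => ->; rewrite subrr.
Qed.

Lemma ideal_symmetric x : odd (s x) != odd x -> forall a b, J (p a b - p b a).
Proof.
move=> sx a b; have s1 : s != 1%g.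
  by apply: contra sx => /eqP ->; rewrite perm1.
apply: in_ideal_by_quotient => Q f fP.
have swaps := quotient_parity_swaps fP s1.
have [C [g [c [g_inj gc]]]] := exists_commutative_matrix (parity_swaps_commute swaps).
have gcE a' b' : g (c a' b') = f (p a' b').
  by move/matrixP: gc => /(_ a' b'); rewrite !mxE.
rewrite rmorphB -!gcE (@symmetric_of_parity_break _ _ c _ _ _ s x) ?subrr //.
- move=> a' b' c' d'; apply: g_inj; rewrite !rmorphM.
  by have := parity_swaps_rank_one swaps a' b' c' d'; rewrite -gc !mxE.
- by apply: g_inj; rewrite -trace_map_mx gc trace_map_mx trp !rmorph1.
- move=> i; apply: g_inj; rewrite !rmorph_perm_word gc -!rmorph_perm_word.
  by apply/eqP; rewrite -subr_eq0 -rmorphB; apply/eqP/fP/(relations (k := 0)).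
Qed.

End Ideals.

(** * The three monomial spaces *)
Section MonomialSpaces.
Context (R : realType) (N : nat) (X : free_projective_space R N).
Local Notation A := (proj_alg X).
Local Notation p := (Defs.coord X).
Local Notation differences rels := [set r.1 - r.2 | r in rels].

Lemma coord_idem : p *m p = p. Proof. by have [] := coord_proj X. Qed.

Lemma coord_tr : \tr p = 1. Proof. by have [] := coord_proj X. Qed.

Lemma star_coord i j : star (p i j) = p j i.
Proof.
have [/matrixP/(_ j i) + _ _] := coord_proj X.
by rewrite !mxE.
Qed.

Lemma nat_invertible n : exists u : A, u * n.+1%:R = 1.
Proof.
have n_neq0 : n.+1%:R != 0 :> R[i] by rewrite pnatr_eq0.
exists (n.+1%:R^-1 *: (1 : A)).
rewrite -[LHS]cstar_scalerAl.
rewrite -[cstar_mul _ _]/((1 : A) * n.+1%:R) mul1r -(scaler_nat n.+1 (1 : A)) scalerA.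
by rewrite mulVf // scale1r.
Qed.

(** The closed ideal generated by a set depends only on the two-sided ideals that
    contain this set. *)
Lemma closed_ideal_gen_eq (G1 G2 : set A) :
  (forall J, two_sided_ideal J -> (G1 `<=` J <-> G2 `<=` J)) ->
  closed_ideal_gen G1 = closed_ideal_gen G2.
Proof.
move=> G12; apply/seteqP; split=> x genx J clJ idJ GJ; apply: genx => //;
  exact/(G12 J idJ).
Qed.

Lemma closed_zero : closed [set (0 : A)].
Proof. exact/accessible_closed_set1/hausdorff_accessible/norm_hausdorff. Qed.

Lemma closed_ideal_gen0 : closed_ideal_gen (set0 : set A) = [set 0].
Proof.
apply/seteqP; split=> [x|x -> J _ [J0 _ _] _]; last exact: J0.
apply; [exact: closed_zero | split => // [x' y -> -> |a x' b ->] | exact: sub0set].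
  by rewrite /= addr0.
by rewrite /= mulr0 mul0r.
Qed.

Lemma complex_relationsP (J : set A) :
  differences (@complex_relations R N X) `<=` J <->
  forall i j k l, J (p i j * p k l - p k l * p i j).
Proof.
split=> [sJ i j k l | comm _ [_ [x [y [xP yP ->]]] <-] /=].
  apply: sJ; exists (p i j * p k l, p k l * p i j) => //.
  exists (p i j), (p k l); split=> //; first by exists i, j; left.
  by exists k, l; left.
have coordP z : @coords_and_adjoints R N X z -> exists i j, z = p i j.
  by case=> i [j [->|->]]; [exists i, j | exists j, i; rewrite star_coord].
by have [[i [j ->]] [k [l ->]]] := (coordP x xP, coordP y yP).
Qed.

Lemma real_relationsP (J : set A) :
  differences (@real_relations R N X) `<=` J <->
  (forall i j k l, J (p i j * p k l - p k l * p i j)) /\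
  (forall i j, J (p i j - p j i)).
Proof.
rewrite image_setU subUset; apply: iff_trans (and_iff_compat_r _ (complex_relationsP J)) _.
split=> -[comm sym]; split=> //.
  by move=> i j; apply: sym; exists (p i j, p j i) => //; exists i, j.
by move=> _ [_ [i [j ->]] <-] /=.
Qed.

Lemma perm_relationsP (E : perm_family) (J : set A) :
  differences (@perm_relations R N X E) `<=` J <->
  forall m (s : 'S_m.*2) i, E m s -> J (perm_word p i - perm_word p (i \o s)).
Proof.
split=> [sJ m s i Es | sJ _ [_ [m [s [i [Es ->]]]] <-] /=]; last exact: sJ.
by apply: sJ; exists (perm_word p i, perm_word p (i \o s)) => //; exists m, s, i.
Qed.

Lemma stable_iter_bars (E : perm_family) m (s : 'S_m.*2) k :
  bars_stable E -> E m s -> E (k + m)%N (iter_bars s k).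
Proof. by move=> stE Es; elim: k => //= k; apply: stE. Qed.

Definition parity_preserving m (s : 'S_m.*2) := forall x, odd (s x) = odd x.

Lemma trivial_family (E : perm_family) : (forall m s, E m s -> s = 1%g) ->
  closed_ideal_gen (differences (@perm_relations R N X E)) = [set 0].
Proof.
move=> E1; rewrite -closed_ideal_gen0; apply: closed_ideal_gen_eq => J idJ.
split=> _; first exact: sub0set.
apply/perm_relationsP => m s i /E1 ->; have [J0 _ _] := idJ.
have -> : perm_word p (i \o (1%g : 'S_m.*2)) = perm_word p i.
  by apply: eq_bigr => j _; rewrite /= !perm1.
by rewrite subrr.
Qed.

Lemma complex_family (E : perm_family) m (s : 'S_m.*2) :
    bars_stable E -> E m s -> s != 1%g ->
    (forall m' s', E m' s' -> parity_preserving s') ->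
  closed_ideal_gen (differences (@perm_relations R N X E)) =
  closed_ideal_gen (differences (@complex_relations R N X)).
Proof.
move=> stE Es s1 parE; apply: closed_ideal_gen_eq => J idJ.
rewrite perm_relationsP complex_relationsP; split=> [rel | comm m' s' i Es'].
  apply: (ideal_commutators coord_idem coord_tr idJ _ s1) => k i.
  exact/rel/(stable_iter_bars k stE Es).
apply: (ideal_perm_relations coord_idem coord_tr idJ nat_invertible comm).
by left; apply: parE.
Qed.

Lemma real_family (E : perm_family) m (s : 'S_m.*2) x :
    bars_stable E -> E m s -> odd (s x) != odd x ->
  closed_ideal_gen (differences (@perm_relations R N X E)) =
  closed_ideal_gen (differences (@real_relations R N X)).
Proof.
move=> stE Es sx; apply: closed_ideal_gen_eq => J idJ.
have s1 : s != 1%g by apply: contra sx => /eqP ->; rewrite perm1.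
rewrite perm_relationsP real_relationsP; split=> [rel | [comm sym] m' s' i Es'].
  have rel' k i : J (perm_word p i - perm_word p (i \o iter_bars s k)).
    exact/rel/(stable_iter_bars k stE Es).
  split; first exact: (ideal_commutators coord_idem coord_tr idJ rel' s1).
  exact: (ideal_symmetric coord_idem coord_tr idJ rel' sx).
apply: (ideal_perm_relations coord_idem coord_tr idJ nat_invertible comm).
by right.
Qed.

End MonomialSpaces.

Theorem theorem2p6 (R : realType) (N : nat) (X : free_projective_space R N) :
  (forall P : nc_subset (proj_alg X), is_real_projective P -> is_monomial P) /\
  (forall P : nc_subset (proj_alg X), is_complex_projective P -> is_monomial P) /\
  is_monomial (whole (proj_alg X)) /\
  (forall P : nc_subset (proj_alg X), is_monomial P ->
     is_real_projective P \/ is_complex_projective P \/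
     subset_eq P (whole (proj_alg X))).
Proof.
have ker_whole : ker_restr (whole (proj_alg X)) = [set 0] by [].
split; [|split; [|split]].
- move=> P realP; pose E : perm_family := fun _ => setT.
  have stE : bars_stable E by [].
  exists E => //; rewrite /obtained_via realP.
  rewrite (@real_family _ _ X E 1 (tperm ord0 ord_max) ord0) //.
  by rewrite tpermL.
- move=> P complexP; pose E : perm_family := fun m => [set s | parity_preserving s].
  have stE : bars_stable E.
    move=> m s Es x; rewrite -perm_fun_ord perm_fun_bars /shift_fun.
    case: ltnP => // x0; rewrite add1n /=.
    have xm : (x - 1 < m.*2.+1)%N by have := ltn_ord x; lia.
    have [lt_x | ge_x] := ltnP (x - 1)%N m.*2; last by rewrite perm_fun_id //; lia.
    by rewrite -[(x - 1)%N]/(val (Ordinal lt_x)) perm_fun_ord Es /=; lia.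
  exists E => //; rewrite /obtained_via complexP.
  pose s : 'S_(2.*2) := tperm ord0 (inord 2).
  rewrite (@complex_family _ _ X E 2 s) //.
    move=> x; rewrite /s; case: tpermP => // ->; by rewrite inordK.
  apply/eqP => /permP /(_ ord0); rewrite perm1 tpermL => /(congr1 val).
  by rewrite /= inordK.
- exists (fun _ => set0); first by [].
  by rewrite /obtained_via trivial_family.
- move=> P [E stE viaE].
  have [[m [s [x [Es sx]]]] | no_break] := pselect (exists m (s : 'S_m.*2) x,
      E m s /\ odd (s x) != odd x).
    left; rewrite /is_real_projective /obtained_via viaE.
    exact: real_family stE Es sx.
  right; have parE m s : E m s -> parity_preserving s.
    move=> Es x; apply/eqP/negPn/negP => sx; apply: no_break.
    by exists m, s, x.
  have [[m [s [Es s1]]] | triv] := pselect (exists m (s : 'S_m.*2),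
      E m s /\ s != 1%g).
    left; rewrite /is_complex_projective /obtained_via viaE.
    exact: complex_family stE Es s1 parE.
  right; rewrite /subset_eq viaE ker_whole; apply: trivial_family => m s Es.
  by apply/eqP/negPn/negP => s1; apply: triv; exists m, s.
Qed.
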